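(* Let $K_i,C\in\mathcal{K}^n$, $i\in[j]$, $j\in\mathbb{N}$. Then $$\mathrm{R}(K_1,C)+\cdots+\mathrm{R}(K_j,C)\ \le\ j\,\mathrm{R}(K_1+\cdots+K_j,C).$$ Equality holds if and only if there exist polyhedral cylinders $C_i$, $i\in[j]$, with facets parallel to $\mathrm{aff}(K_1+\cdots+\widehat{K_i}+\cdots+K_j)$, and some $\lambda>0$ and $z\in\mathbb{R}^n$ such that $$K_1+\cdots+K_j\ \subset\ z+\lambda C\ \subset\ C_1\cap\cdots\cap C_j$$ with $\mathrm{R}(K_1,C_1)=\cdots=\mathrm{R}(K_j,C_j)=1$.
   Context: $[j]:=\{1,\dots,j\}$. $\mathcal{K}^n$ denotes the set of all $n$-dimensional convex bodies, i.e., convex and compact sets, in $\mathbb{R}^n$. Sums of sets are Minkowski (vector) sums. The circumradius $\mathrm{R}(K,C)$ of $K$ with respect to a convex set $C$ is the smallest $\lambda\ge 0$ such that $\lambda C$ contains a translate of $K$; the same definition is used when the second set is one of the (possibly unbounded) cylinders $C_i$. $K_1+\cdots+\widehat{K_i}+\cdots+K_j$ denotes the sum of all sets $K_m$ with $m\in[j]\setminus\{i\}$ (the empty sum being $\{0\}$), and $\mathrm{aff}$ denotes the affine hull. A polyhedral cylinder here is an intersection of finitely many closed half-spaces of $\mathbb{R}^n$; it has facets parallel to an affine subspace $A$ if, for each of its facets, the linear subspace $A-A$ is contained in the linear hyperplane parallel to that facet.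
   Formalization: The equality case is stated when not all K_i are single points and R(K_1+...+K_j,C) is finite (both automatic for full-dimensional bodies, n≥1); otherwise both sides are equal (0 or infinite) but no such cylinders exist, so the literal equivalence fails. *)

(* Defs.v *)
From mathcomp Require Export all_boot all_order all_algebra.
From mathcomp Require Export all_classical all_reals all_analysis.
Export Order.TTheory GRing.Theory Num.Theory.
Export numFieldNormedType.Exports.

Set Implicit Arguments.
Unset Strict Implicit.
Unset Printing Implicit Defensive.

Local Open Scope classical_set_scope.
Local Open Scope ring_scope.

Section Defs.
Context {R : realType} {n : nat}.
Notation V := 'rV[R]_n.
Implicit Types (A B C K S P F : set V) (u v z t : V) (a b l : R).

(* Lower-dimensional bodies are allowed. *)
Definition convex_body K : Prop := [/\ K !=set0, convex_set K & compact K].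

Definition minkowski A B : set V := [set x + y | x in A & y in B].

Definition minkowski_sum j (D : pred 'I_j) (K : 'I_j -> set V) : set V :=
  \big[minkowski/[set 0]]_(m < j | D m) K m.

Definition homothet z l C : set V := [set z + l *: x | x in C].

(* The smallest l >= 0 such that l C contains a translate of K, and +oo if
   there is no such l.  For compact C the infimum is attained as soon as it is
   finite; for a polyhedron C it is attained whenever it is finite and positive
   (for C the whole space and K not a singleton it is 0, not attained). *)
Definition circumradius K C : \bar R :=
  ereal_inf [set l%:E | l in [set l | 0 <= l /\
    exists t, homothet t 1 K `<=` homothet 0 l C]].

Definition affine_hull S : set V :=
  [set x | exists k (p : 'I_k -> V) (c : 'I_k -> R),
     [/\ forall i, S (p i), \sum_i c i = 1 & x = \sum_i c i *: p i]].

(* A - A; for an affine subspace A, the linear subspace parallel to it. *)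
Definition direction A : set V := [set x - y | x in A & y in A].

Definition dot u v : R := \sum_i u 0 i * v 0 i.

Definition halfspace u b : set V := [set x | dot u x <= b].

Definition hyperplane u b : set V := [set x | dot u x = b].

(* S is nonempty and its affine hull has dimension d: the affine hull is p plus
   the row space of a matrix with d linearly independent rows. *)
Definition has_dim S (d : nat) : Prop :=
  exists (p : V) (M : 'M[R]_(d, n)),
    row_free M /\ affine_hull S = [set x | (x - p <= M)%MS].

Definition polyhedral_cylinder P : Prop :=
  exists k (u : 'I_k -> V) (b : 'I_k -> R),
    (forall i, u i != 0) /\ P = \bigcap_i halfspace (u i) (b i).

(* A face cut out by a supporting hyperplane, of dimension dim P - 1; the case
   u = 0 is excluded by the dimension condition. *)
Definition facet P F : Prop :=
  exists u b, [/\ P `<=` halfspace u b, F = P `&` hyperplane u b &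
    exists d, has_dim P d.+1 /\ has_dim F d].

(* For a full-dimensional P, direction (affine_hull F) is the linear hyperplane
   parallel to the facet F. *)
Definition facets_parallel_to P A : Prop :=
  forall F, facet P F -> direction A `<=` direction (affine_hull F).

End Defs.

(* Main.v *)
From HB Require Import structures.
Require Import Defs.
From mathcomp Require Import ring lra.

(** K contains a translate of each K_i, so R(K_i,C) <= R(K,C), where
K = K_1 + ... + K_j; equality in the sum means equality for every i.  Given the
cylinders, R(K_i,C_i) = 1 and z + lambda C <= C_i force
R(K_i,C) >= lambda >= R(K,C); the shape of the C_i plays no role here.

Conversely, put D = z + R(K,C) C, which contains K, and let p be a relative
interior point of L = K_1 + ... + \hat K_i + ... + K_j.  Since K_i + p lies in D
and fits in no smaller copy of D, the outer normals of D at the points of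
K_i + p have 0 in their convex hull: otherwise the hull's point nearest to 0
gives a direction in which K_i + p can be pushed off the boundary of D.  By
Caratheodory finitely many normals suffice, and the corresponding supporting
halfspaces of D intersect in C_i.  Such a normal is maximal over L at p, hence
constant on L, so C_i is invariant under translations parallel to aff L.

C may be lower-dimensional, so only normals in the linear space parallel to
aff D are used; those are never constant on D. *)

Set Implicit Arguments.
Unset Strict Implicit.
Unset Printing Implicit Defensive.

Local Open Scope classical_set_scope.
Local Open Scope ring_scope.

(** * Scalar product *)

Section Dot.
Context {R : realType} {n : nat}.
Implicit Types (u v w : 'rV[R]_n) (a : R).

Lemma dotC u v : dot u v = dot v u.
Proof. by apply: eq_bigr => i _; rewrite mulrC. Qed.

Lemma dotDr u v w : dot u (v + w) = dot u v + dot u w.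
Proof. by rewrite -big_split; apply: eq_bigr => i _; rewrite mxE mulrDr. Qed.

Lemma dotZr a u v : dot u (a *: v) = a * dot u v.
Proof. by rewrite mulr_sumr; apply: eq_bigr => i _; rewrite mxE mulrCA. Qed.

Lemma dotDl u v w : dot (u + v) w = dot u w + dot v w.
Proof. by rewrite dotC dotDr !(dotC w). Qed.

Lemma dotZl a u v : dot (a *: u) v = a * dot u v.
Proof. by rewrite dotC dotZr dotC. Qed.

Lemma dotNr u v : dot u (- v) = - dot u v.
Proof. by rewrite -scaleN1r dotZr mulN1r. Qed.

Lemma dotNl u v : dot (- u) v = - dot u v.
Proof. by rewrite dotC dotNr dotC. Qed.

Lemma dotBr u v w : dot u (v - w) = dot u v - dot u w.
Proof. by rewrite dotDr dotNr. Qed.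

Lemma dotBl u v w : dot (u - v) w = dot u w - dot v w.
Proof. by rewrite dotDl dotNl. Qed.

Lemma dot0r u : dot u 0 = 0.
Proof. by rewrite -(scale0r 0) dotZr mul0r. Qed.

Lemma dot0l u : dot 0 u = 0.
Proof. by rewrite dotC dot0r. Qed.

Lemma dot_sumr (I : Type) (r : seq I) (P : pred I) u (F : I -> 'rV[R]_n) :
  dot u (\sum_(i <- r | P i) F i) = \sum_(i <- r | P i) dot u (F i).
Proof. by apply: (big_morph (dot u)) => [? ?|]; rewrite (dotDr, dot0r). Qed.

Lemma dot_suml (I : Type) (r : seq I) (P : pred I) u (F : I -> 'rV[R]_n) :
  dot (\sum_(i <- r | P i) F i) u = \sum_(i <- r | P i) dot (F i) u.
Proof. by rewrite dotC dot_sumr; apply: eq_bigr => i _; rewrite dotC. Qed.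

Lemma dot_ge0 u : 0 <= dot u u.
Proof. by apply: sumr_ge0 => i _; rewrite -expr2 sqr_ge0. Qed.

Lemma dot_eq0 u : (dot u u == 0) = (u == 0).
Proof.
apply/eqP/eqP => [u0|->]; last exact: dot0r.
apply/rowP => i; rewrite mxE; apply/eqP; rewrite -[_ == _]orbb -mulf_eq0.
move/eqP: u0; rewrite psumr_eq0 => [/allP/(_ i (mem_index_enum _))//|k _].
by rewrite -expr2 sqr_ge0.
Qed.

Lemma dot_gt0 u : u != 0 -> 0 < dot u u.
Proof. by move=> u0; rewrite lt_def dot_eq0 u0 dot_ge0. Qed.

(** First-order condition at a minimum over a segment: dividing by s and letting s tend to 0 gives d
    <= 0. If d > 0, the single value s = d / (d + q) already violates the hypothesis. *)
Lemma le0_of_quadratic (d q : R) : 0 <= q ->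
  (forall s, 0 <= s <= 1 -> 2 * s * d <= s ^+ 2 * q) -> d <= 0.
Proof.
move=> q0 step; rewrite leNgt; apply/negP => d0.
pose s := d / (d + q); have dq : 0 < d + q by rewrite ltr_wpDr.
have s0 : 0 < s by rewrite divr_gt0.
have s1 : s <= 1 by rewrite ler_pdivrMr // mul1r lerDl.
have sdq : s * (d + q) = d by rewrite divfK ?gt_eqF.
have := step s; rewrite (ltW s0) s1 => /(_ isT).
have -> : s ^+ 2 * q = s * (d - s * d) by rewrite -{1}sdq; ring.
rewrite -mulrA mulrCA ler_pM2l //; nra.
Qed.

End Dot.

(** * Continuity, closedness and compactness *)

Section Topology.
Context {R : realType} {n : nat}.

Lemma continuous_sum (T : topologicalType) (V : normedModType R) m
    (f : 'I_m -> T -> V) :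
  (forall i, continuous (f i)) -> continuous (fun x => \sum_i f i x).
Proof.
move=> cf x; apply: cvg_big => [|i _]; first exact: add_continuous.
exact: cf.
Qed.

Lemma continuous_dot (T : topologicalType) (f g : T -> 'rV[R]_n) :
  continuous f -> continuous g -> continuous (fun x => dot (f x) (g x)).
Proof.
move=> cf cg; apply: continuous_sum => i x; apply: cvgM.
  exact: (cvg_comp _ _ (cf x) (@coord_continuous R 1 n 0 i (f x))).
exact: (cvg_comp _ _ (cg x) (@coord_continuous R 1 n 0 i (g x))).
Qed.

Lemma continuous_scale (T : topologicalType) (f : T -> R) (g : T -> 'rV[R]_n) :
  continuous f -> continuous g -> continuous (fun x => f x *: g x).
Proof. by move=> cf cg x; apply: cvgZ; [exact: cf|exact: cg]. Qed.

Lemma continuous_add (T : topologicalType) (V : normedModType R)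
    (f g : T -> V) :
  continuous f -> continuous g -> continuous (fun x => f x + g x).
Proof. by move=> cf cg x; apply: cvgD; [exact: cf|exact: cg]. Qed.

Lemma continuous_sub (T : topologicalType) (V : normedModType R)
    (f g : T -> V) :
  continuous f -> continuous g -> continuous (fun x => f x - g x).
Proof. by move=> cf cg x; apply: cvgB; [exact: cf|exact: cg]. Qed.

Lemma continuous_idfun (T : topologicalType) : continuous (fun x : T => x).
Proof. by move=> x; exact: cvg_id. Qed.

Lemma continuous_fst (T U : topologicalType) :
  continuous (fun x : T * U => x.1).
Proof. by move=> x; exact: cvg_fst. Qed.

Lemma continuous_snd (T U : topologicalType) :
  continuous (fun x : T * U => x.2).
Proof. by move=> x; exact: cvg_snd. Qed.

Lemma continuous_mul (T : topologicalType) (f g : T -> R) :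
  continuous f -> continuous g -> continuous (fun x => f x * g x).
Proof. by move=> cf cg x; apply: cvgM; [exact: cf|exact: cg]. Qed.

Lemma continuous_compose (S T U : topologicalType) (g : T -> U) (f : S -> T) :
  continuous g -> continuous f -> continuous (fun x => g (f x)).
Proof. by move=> cg cf x; apply: (cvg_comp _ _ (cf x)); exact: cg. Qed.

(** The entries live in an arbitrary topological space because [compact_convex_comb] uses rows whose
    entries are themselves row vectors. *)
Lemma rV_coord_continuous (T : topologicalType) m (k : 'I_m) :
  continuous (fun v : 'rV[T]_m => v 0 k).
Proof.
move=> v A Av; exists (fun i j => if j == k then A else setT).
  move=> i j; rewrite ord1; case: eqP => [->//|_]; exact: filterT.
by move=> w /= /(_ 0 k); rewrite eqxx.
Qed.

Lemma closed_le_fun (T : topologicalType) (f g : T -> R) :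
  continuous f -> continuous g -> closed [set x | f x <= g x].
Proof.
move=> cf cg; have -> : [set x | f x <= g x] =
    (fun x => f x - g x) @^-1` [set y | y <= 0].
  by apply/seteqP; split => x /=; rewrite subr_le0.
apply: preimage_closed; last exact: closed_le.
by move=> x _; apply: cvgB; [exact: cf|exact: cg].
Qed.

Lemma closed_forall (T : topologicalType) (I : Type) (A : set I)
    (P : I -> T -> Prop) :
  (forall i, A i -> closed [set x | P i x]) ->
  closed [set x | forall i, A i -> P i x].
Proof.
by move=> cP; exact: (@closed_bigI T I A (fun i => [set x | P i x])).
Qed.

Lemma compact_argmin (T : topologicalType) (f : T -> R) (A : set T) :
  A !=set0 -> compact A -> continuous f ->
  exists2 c, A c & forall t, A t -> f c <= f t.
Proof.
move=> A0 Ac cf; have [c cA cmin] := compact_EVT_min A0 Ac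
  (continuous_subspaceT cf).
by exists c => [|t tA]; [exact: set_mem|apply: cmin; exact: mem_set].
Qed.

End Topology.

(** * Convex sets *)

Section Convexity.
Context {R : realType} {n : nat}.
Implicit Types (A D L M : set 'rV[R]_n) (x y : 'rV[R]_n).

Lemma convex_setP A : convex_set A <->
  forall x y (s : R), A x -> A y -> 0 <= s <= 1 -> A (s *: x + (1 - s) *: y).
Proof.
split=> [cA x y s Ax Ay s01|cA x y s /set_mem Ax /set_mem Ay].
  case/andP: s01 => s0 s1.
  by have /set_mem := cA x y (Itv01 s0 s1) (mem_set Ax) (mem_set Ay).
by apply: mem_set; apply: cA => //; rewrite ge0 le1.
Qed.

Lemma convex_sum A m (x : 'I_m -> 'rV[R]_n) (w : 'I_m -> R) :
  convex_set A -> (forall i, A (x i)) -> (forall i, 0 <= w i) ->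
  \sum_i w i = 1 -> A (\sum_i w i *: x i).
Proof.
move=> /convex_setP cA; elim: m => [|m IHm] in x w *.
  by rewrite big_ord0 => _ _ /eqP; rewrite eq_sym oner_eq0.
move=> Ax w0 w1; rewrite big_ord_recl /=.
pose s := \sum_(i < m) w (lift ord0 i).
have sE : 1 - w ord0 = s by rewrite -w1 big_ord_recl addrC addKr.
have s0 : 0 <= s by apply: sumr_ge0.
(* If the remaining weights sum to 0 they cannot be renormalised, but then each of them vanishes. *)
have [s_eq0|sN0] := eqVneq s 0.
  rewrite big1 => [|i _]; last first.
    move/eqP: s_eq0; rewrite psumr_eq0 // => /allP/(_ i (mem_index_enum _))/=.
    by move=> /eqP ->; rewrite scale0r.
  by move/eqP: sE; rewrite s_eq0 subr_eq0 => /eqP <-; rewrite scale1r addr0.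
have <- : (1 - w ord0) *: (\sum_(i < m) (s^-1 * w (lift ord0 i)) *:
    x (lift ord0 i)) = \sum_(i < m) w (lift ord0 i) *: x (lift ord0 i).
  rewrite scaler_sumr; apply: eq_bigr => i _.
  by rewrite scalerA mulrA sE divff ?mul1r.
apply: cA => //; last by rewrite w0 -subr_ge0 sE.
apply: IHm => // [i|]; first by rewrite mulr_ge0 ?invr_ge0.
by rewrite -mulr_sumr mulVf.
Qed.

End Convexity.

(** * Convex hulls of compact sets *)

Section Caratheodory.
Context {R : realType} {n : nat}.
Implicit Types (N : set 'rV[R]_n) (x y : 'rV[R]_n).

(** Fixing the number m of points, repetitions allowed, makes this a continuous image of a compact
    set when N is compact. For m = n + 1 it is the whole convex hull. *)
Definition convex_comb m N : set 'rV[R]_n :=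
  [set x | exists (a : 'I_m -> 'rV[R]_n) (w : 'I_m -> R),
    [/\ forall i, N (a i), forall i, 0 <= w i, \sum_i w i = 1 &
        x = \sum_i w i *: a i]].

(** Appending a coordinate 1 to each point gives n + 2 vectors in dimension n + 1, hence a linear
    relation. Its coefficients sum to 0 and are not all 0, so one is positive. *)
Lemma affine_dependency (a : 'I_n.+2 -> 'rV[R]_n) :
  exists c : 'I_n.+2 -> R,
    [/\ \sum_i c i = 0, \sum_i c i *: a i = 0 & exists i, 0 < c i].
Proof.
pose A : 'M[R]_(n.+2, n + 1) := row_mx (\matrix_i a i) (const_mx 1).
have : kermx A != 0.
  rewrite -mxrank_eq0 mxrank_ker subn_eq0 -ltnNge.
  by rewrite (leq_ltn_trans (rank_leq_col _)) // addn1.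
case/rowV0Pn => c /sub_kermxP cA c0.
have sumc (F : 'I_n.+2 -> 'rV[R]_n) : c *m (\matrix_i F i) = \sum_i c 0 i *: F i.
  by rewrite mulmx_sum_row; apply: eq_bigr => i _; rewrite rowK.
move: cA; rewrite mul_mx_row -row_mx0 => /eq_row_mx[].
rewrite sumc => ca0 /matrixP/(_ 0 0); rewrite !mxE.
under eq_bigr do rewrite mxE mulr1.
move=> c1; exists (c 0); split=> //.
apply/existsP; apply: contraNT c0 => /existsPn cle0; apply/eqP/rowP => i.
rewrite mxE; apply/eqP; rewrite -oppr_eq0.
have: \sum_i - c 0 i == 0 by rewrite sumrN c1 oppr0.
rewrite psumr_eq0 => [/allP/(_ i (mem_index_enum _))//|k _].
by rewrite oppr_ge0 leNgt cle0.
Qed.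

(** Subtracting t times an affine dependency c changes neither the point nor the total weight. With
    t the least ratio w i / c i over c i > 0, all weights stay nonnegative and the one at k becomes
    0. *)
Lemma caratheodory N : convex_comb n.+2 N `<=` convex_comb n.+1 N.
Proof.
move=> _ [a [w [Na w0 w1 ->]]]; have [c [c0 ca0 [i0 ci0]]] := affine_dependency a.
have [k ck kmin] :=
  @arg_minP _ R _ i0 (fun i => 0 < c i) (fun i => w i / c i) ci0.
pose t := w k / c k; pose w' i := w i - t * c i.
have w'k : w' k = 0 by rewrite /w' /t divfK ?subrr ?gt_eqF.
have drop (F : 'I_n.+2 -> 'rV[R]_n) : \sum_i w' i *: F i =
    \sum_i w' (lift k i) *: F (lift k i).
  by rewrite (bigD1_ord k) //= w'k scale0r add0r.
have w'1 : \sum_i w' i = 1 by rewrite sumrB -mulr_sumr c0 mulr0 subr0.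
exists (a \o lift k), (w' \o lift k); split=> [i|i||] /=; first exact: Na.
- rewrite subr_ge0; have [ci|ci] := ltP 0 (c (lift k i)).
    by rewrite -ler_pdivlMr // kmin.
  rewrite (le_trans _ (w0 _)) // mulr_ge0_le0 //.
  by rewrite divr_ge0 // ltW.
- by rewrite -w'1 (bigD1_ord k) //= w'k add0r.
rewrite -drop /w'; under [RHS]eq_bigr do rewrite scalerBl -scalerA.
by rewrite sumrB -scaler_sumr ca0 scaler0 subr0.
Qed.

Lemma compact_convex_comb m N : compact N -> compact (convex_comb m N).
Proof.
move=> Nc.
pose T := ('rV['rV[R]_n]_m * 'rV[R]_m)%type.
pose X := ([set a : 'rV['rV[R]_n]_m | forall i, N (a 0 i)] `*`
  [set w : 'rV[R]_m | forall i, `[0, 1]%classic (w 0 i)]) `&`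
  [set v : T | \sum_i v.2 0 i = 1].
have c1 (i : 'I_m) : continuous (fun v : T => v.1 0 i).
  move=> v; apply: (@continuous_comp _ _ _ fst (fun a : 'rV__ => a 0 i)).
    exact: cvg_fst.
  exact: rV_coord_continuous.
have c2 (i : 'I_m) : continuous (fun v : T => v.2 0 i).
  move=> v; apply: (@continuous_comp _ _ _ snd (fun a : 'rV__ => a 0 i)).
    exact: cvg_snd.
  exact: rV_coord_continuous.
have -> : convex_comb m N = (fun v : T => \sum_i v.2 0 i *: v.1 0 i) @` X.
  apply/seteqP; split=> [x [a [w [Na w0 w1 ->]]]|_ [v [[/= vN v01] v1] <-]].
    exists (\row_i a i, \row_i w i); last first.
      by apply: eq_bigr => i _; rewrite !mxE.
    split=> /=; last by rewrite -w1; apply: eq_bigr => i _; rewrite mxE.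
    split=> i /=; rewrite mxE // in_itv /= w0 -w1 (bigD1 i) //=.
    by rewrite lerDl sumr_ge0.
  exists (fun i => v.1 0 i), (fun i => v.2 0 i); split=> // i.
  by have := v01 i; rewrite /= in_itv => /andP[].
apply: continuous_compact.
  apply: continuous_subspaceT; apply: continuous_sum => i.
  exact: continuous_scale (c2 i) (c1 i).
apply: compact_closedI.
  apply: compact_setX; first exact: (@rV_compact _ _ (fun=> N)).
  apply: (@rV_compact R m (fun=> `[0, 1]%classic)) => _.
  exact: segment_compact.
apply: (@preimage_closed _ _ (fun v : T => \sum_i v.2 0 i) [set 1]).
  by move=> v _; apply: continuous_sum.
exact: closed_eq.
Qed.

(** The point x of the hull nearest to 0 exists by compactness; moving from x towards a cannot
    decrease the norm, which yields the inequality. *)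
Lemma min_norm_convex_comb N : N !=set0 -> compact N ->
  exists2 x, convex_comb n.+1 N x & forall a, N a -> dot x x <= dot x a.
Proof.
move=> [a0 Na0] Nc.
have [||x Hx xmin] := @compact_argmin R _ (fun x : 'rV[R]_n => dot x x)
  (convex_comb n.+1 N) _ (compact_convex_comb Nc).
- exists a0, (fun=> a0), (fun i => (i == ord0)%:R); split=> //.
    by rewrite (bigD1 ord0) //= big1 ?addr0 // => i /negPf ->.
  rewrite (bigD1 ord0) //= scale1r big1 ?addr0 // => i /negPf ->.
  by rewrite scale0r.
- by apply: continuous_dot => ?; exact: cvg_id.
exists x => // a Na; have [a' [w [Na' w0 w1 xE]]] := Hx.
(* Mixing x with a uses n + 2 points; [caratheodory] brings them back to n + 1. *)
have step s : 0 <= s <= 1 -> dot x x <= dot (x + s *: (a - x)) (x + s *: (a - x)).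
  move=> /andP[s0 s1]; apply: xmin; apply: caratheodory.
  exists (fun i => if unlift ord0 i is Some k then a' k else a),
    (fun i => if unlift ord0 i is Some k then (1 - s) * w k else s).
  split=> [i|i||]; first by case: unliftP.
  - by case: unliftP => // k _; rewrite mulr_ge0 // subr_ge0.
  - rewrite big_ord_recl unlift_none; under eq_bigr do rewrite liftK.
    by rewrite -mulr_sumr w1 mulr1 addrC subrK.
  rewrite big_ord_recl unlift_none; under eq_bigr do rewrite liftK -scalerA.
  rewrite -scaler_sumr -xE scalerBl scalerBr scale1r.
  by rewrite addrCA.
rewrite -subr_le0; apply: (le0_of_quadratic (dot_ge0 (a - x))) => s.
set q := dot (a - x) (a - x) => /step.
rewrite dotDl !dotDr !dotZl !dotZr -/q (dotC (a - x) x) (dotBr x); lra.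
Qed.

End Caratheodory.

(** * Touching normals and optimal containment *)

Section Touching.
Context {R : realType} {n : nat}.
Notation V := 'rV[R]_n.
Implicit Types (D L M : set V) (a p q u v x y : V).

(** Here d is the point of D nearest to y. If y lies in D, then d = y and the inequality is
    trivial. *)
Lemma separating_projection D y : D !=set0 -> compact D -> convex_set D ->
  exists2 d, D d & forall x, D x -> dot (y - d) x <= dot (y - d) d.
Proof.
move=> D0 Dc /convex_setP Dconv.
have [|d Dd dmin] :=
  @compact_argmin R _ (fun x : V => dot (y - x) (y - x)) D D0 Dc.
  have cB := continuous_sub (@cst_continuous _ _ y) (@continuous_idfun V).
  exact: (continuous_dot cB cB).
exists d => // x Dx; rewrite -subr_le0 -dotBr.
apply: (le0_of_quadratic (dot_ge0 (x - d))) => s s01.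
set q := dot (x - d) (x - d).
have := dmin _ (Dconv x d s Dx Dd s01).
have -> : y - (s *: x + (1 - s) *: d) = (y - d) - s *: (x - d).
  by apply/rowP => i; rewrite !mxE; ring.
rewrite (dotBl (y - d)) !(dotBr _ (y - d)) !dotZl !dotZr.
rewrite (dotC (x - d) (y - d)) -/q; lra.
Qed.

(* The barycenter of points of L whose differences to a base point have maximal
   rank lies in the relative interior of L. *)
Lemma relint_point L : L !=set0 -> convex_set L ->
  exists2 p, L p & forall a, (forall x, L x -> dot a x <= dot a p) ->
    forall x, L x -> dot a x = dot a p.
Proof.
move=> [l0 Ll0] Lconv.
pose P r := exists k (f : 'I_k -> V), (forall i, L (f i)) /\
  \rank (\matrix_i (f i - l0)) = r.
have exP : exists r, `[<P r>].
  by exists 0%N; apply/asboolP; exists 0%N, (fun=> 0); split=> [[]//|];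
    rewrite flatmx0 mxrank0.
have ubP r : `[<P r>] -> (r <= n)%N.
  by move=> /asboolP[k [f [_ <-]]]; exact: rank_leq_col.
case: (ex_maxnP exP ubP) => r /asboolP[k [f [Lf rk]]] rmax.
(* Otherwise adjoining x to the points f would raise the maximal rank r. *)
have spanL x : L x -> (x - l0 <= \matrix_i (f i - l0))%MS.
  move=> Lx; apply: contraT => xN.
  have: (r.+1 <= r)%N; last by rewrite ltnn.
  pose g (i : 'I_(1 + k)) := if fintype.split i is inr j then f j else x.
  have gE : \matrix_i (g i - l0) = col_mx (x - l0) (\matrix_i (f i - l0)).
    apply/row_matrixP => i; rewrite rowK /g -{2}(fintype.splitK i).
    case: (fintype.split i) => j /=; first by rewrite rowKu ord1 row_id.
    by rewrite rowKd rowK.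
  apply: leq_trans (rmax (\rank (\matrix_i (g i - l0))) _); last first.
    apply/asboolP; exists (1 + k)%N, g; split=> // i.
    by rewrite /g; case: fintype.split.
  rewrite gE -rk -addsmxE (ltn_leqif (mxrank_leqif_sup (addsmxSr _ _))).
  by rewrite addsmx_sub (negPf xN).
(* The base point l0 joins the barycenter, so that a functional maximal at p is also determined at
   l0. *)
pose h (i : 'I_k.+1) := if unlift ord0 i is Some j then f j else l0.
have Lh i : L (h i) by rewrite /h; case: unliftP.
pose c : R := k.+1%:R^-1; have c0 : 0 < c by rewrite invr_gt0 ltr0n.
have c1 : \sum_(i < k.+1) c = 1.
  by rewrite sumr_const card_ord -mulr_natl mulfV // pnatr_eq0.
pose p := \sum_(i < k.+1) c *: h i; exists p => [|a pmax x Lx].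
  by apply: convex_sum => // i; exact: ltW.
(* dot a p is a mean, with positive weights, of values not exceeding it, so all of them equal it. *)
have hp i : dot a (h i) = dot a p.
  have: \sum_(i < k.+1) c * (dot a p - dot a (h i)) == 0.
    under eq_bigr => m _ do rewrite mulrBr -(dotZr c a (h m)).
    by rewrite sumrB -mulr_suml c1 mul1r -dot_sumr subrr.
  rewrite psumr_eq0 => [/allP/(_ i (mem_index_enum _))|m _]; last first.
    by apply: mulr_ge0; [exact: ltW|rewrite subr_ge0 pmax].
  by rewrite /= mulf_eq0 gt_eqF //= subr_eq0 => /eqP.
have hl0 : dot a l0 = dot a p by rewrite -(hp ord0) /h unlift_none.
have /submxP[b xE] := spanL x Lx.
rewrite -(subrK l0 x) dotDr hl0 xE mulmx_sum_row dot_sumr big1 ?add0r // => i _.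
rewrite rowK dotZr dotBr hl0; have := hp (lift ord0 i).
by rewrite /h liftK => ->; rewrite subrr mulr0.
Qed.

(* The double orthogonal of D - D, i.e. the linear space parallel to aff D. *)
Definition direction_space D : set V :=
  [set u | forall w, (forall x y, D x -> D y -> dot w (x - y) = 0) ->
    dot w u = 0].

(** The norm is the sup norm of matrices, not the one induced by [dot]; the normalisation only
    serves to give compactness and to exclude 0. *)
Definition unit_directions D : set V :=
  [set a | direction_space D a /\ `|a| = 1].

Definition touching_normals M D : set V :=
  [set a | unit_directions D a /\
    exists2 q, M q & forall x, D x -> dot a x <= dot a q].

Lemma direction_spaceB D x y : D x -> D y -> direction_space D (x - y).
Proof. by move=> Dx Dy w; exact. Qed.

Lemma direction_spaceD D u v :
  direction_space D u -> direction_space D v -> direction_space D (u + v).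
Proof. by move=> Du Dv w Dw; rewrite dotDr Du // Dv // addr0. Qed.

Lemma direction_spaceZ D (s : R) u :
  direction_space D u -> direction_space D (s *: u).
Proof. by move=> Du w Dw; rewrite dotZr Du // mulr0. Qed.

(** If a were constant on D, it would be orthogonal to D - D, hence to itself by the double
    orthogonal. *)
Lemma direction_space_nonconst D a : direction_space D a -> a != 0 ->
  exists x y, [/\ D x, D y & dot a x < dot a y].
Proof.
move=> Da /dot_gt0; apply: contraPP => Dconst; rewrite Da ?ltxx // => x y Dx Dy.
rewrite dotBr; apply/eqP; rewrite subr_eq0; apply: contrapT => /negP.
by rewrite neq_lt => /orP[lt|lt]; apply: Dconst; [exists x, y|exists y, x].
Qed.

Lemma compact_unit_directions D : compact (unit_directions D).
Proof.
apply: bounded_closed_compact.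
  exists 1; split=> // s s1 a [_ a1] /=; by rewrite a1 ltW.
apply: closedI; last first.
  apply: (@preimage_closed _ _ (fun a : V => `|a|) [set 1]).
    by move=> a _; exact: norm_continuous.
  exact: closed_eq.
apply: (@closed_forall _ _ [set w | _] (fun w u => dot w u = 0)) => w _.
apply: (@preimage_closed _ _ (dot w) [set 0]); last exact: closed_eq.
move=> u _; apply: (continuous_dot (f := fun=> w) (g := id)).
  exact: cst_continuous.
exact: continuous_idfun.
Qed.

Lemma compact_touching_normals M D :
  compact M -> compact (touching_normals M D).
Proof.
move=> Mc.
have -> : touching_normals M D = snd @` ((M `*` unit_directions D) `&`
    [set qa : V * V | forall x, D x -> dot qa.2 x <= dot qa.2 qa.1]).
  apply/seteqP; split=> [a [Ua [q Mq qmax]]|_ [[q a] [[Mq Ua] qmax] <-]].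
    by exists (q, a).
  by split=> //; exists q.
apply: continuous_compact.
  by apply: continuous_subspaceT; exact: continuous_snd.
apply: compact_closedI.
  exact: compact_setX Mc (compact_unit_directions (D := D)).
apply: closed_forall => x _; apply: closed_le_fun; apply: continuous_dot.
- exact: continuous_snd.
- exact: cst_continuous.
- exact: continuous_snd.
- exact: continuous_fst.
Qed.

(** Moving M by e v gains room of first order in e at the touching points, while shrinking D about
    x0 by the factor 1 - e^2 costs only second order. Compactness provides one e that works for all
    points of M. *)
Lemma shrink M D x0 v : compact M -> compact D -> convex_set D -> D x0 ->
  M `<=` D -> direction_space D v ->
  (forall a, touching_normals M D a -> dot a v < 0) ->
  exists l t, 0 <= l < 1 /\ forall q, M q -> exists2 d, D d & t + q = l *: d.
Proof.
move=> Mc Dc Dconv Dx0 MD Dv vneg.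
pose T := (R * (V * V))%type.
(* E collects the triples (e, q, a) where a weakly separates q + e v from the
   shrunken copy of D.  On E, psi is nonnegative for e > 0 (take x = q) and
   negative for e = 0, where a touches; by compactness E contains no triple with
   small e > 0. *)
pose E : set T := (`[0, 1]%classic `*` (M `*` unit_directions D)) `&`
  [set z : T | forall x, D x ->
    dot z.2.2 (x0 + (1 - z.1 ^+ 2) *: (x - x0)) <= dot z.2.2 (z.2.1 + z.1 *: v)].
have ce : continuous (fun z : T => z.1) by exact: continuous_fst.
have c2 : continuous (fun z : T => z.2) by exact: continuous_snd.
have cq : continuous (fun z : T => z.2.1).
  exact: (continuous_compose (@continuous_fst _ _) c2).
have ca : continuous (fun z : T => z.2.2).
  exact: (continuous_compose (@continuous_snd _ _) c2).
have cc (U : topologicalType) (c : U) : continuous (fun _ : T => c).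
  exact: cst_continuous.
have Ec : compact E.
  apply: compact_closedI.
    apply: compact_setX; first exact: segment_compact.
    exact: compact_setX Mc (compact_unit_directions (D := D)).
  apply: closed_forall => x _.
  have c1 := continuous_sub (cc R 1) (continuous_mul ce ce).
  have cl := continuous_add (cc V x0) (continuous_scale c1 (cc V (x - x0))).
  have cr := continuous_add cq (continuous_scale ce (cc V v)).
  exact: (closed_le_fun (continuous_dot ca cl) (continuous_dot ca cr)).
pose psi (z : T) := z.1 * dot z.2.2 (z.2.1 - x0) + dot z.2.2 v.
have cpsi : continuous psi.
  have cqx := continuous_sub cq (cc V x0).
  exact: (continuous_add (continuous_mul ce (continuous_dot ca cqx))
    (continuous_dot ca (cc V v))).
have psi_ge0 z : E z -> 0 < z.1 -> 0 <= psi z.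
  case: z => e [q a] /= [[_ [/MD Dq _]] /(_ q Dq) /=]; rewrite /psi /= => + e0.
  rewrite !dotDr !dotZr !dotDr !dotNr => ineq; rewrite -(pmulr_rge0 _ e0).
  lra.
have psi_lt0 z : E z -> z.1 = 0 -> psi z < 0.
  case: z => e [q a] /= [[_ [Mq Ua]] /= max] e0; subst e.
  rewrite /psi /= mul0r add0r; apply: vneg; split=> //; exists q => // x Dx.
  have := max x Dx; rewrite expr0n /= subr0 scale1r scale0r addr0.
  by rewrite addrCA subrr addr0.
have [e [e0 e1 eE]] : exists e : R, [/\ 0 < e, e <= 2^-1 &
    forall q a, ~ E (e, (q, a))].
  (* The least first component e' of such triples is positive, because psi < 0 where e = 0. So any
     positive e below e' avoids E; the bound 1/2 keeps 1 - e^2 positive. *)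
  have [F0|F0] := pselect ((E `&` [set z | 0 <= psi z]) !=set0).
    have Fc : compact (E `&` [set z | 0 <= psi z]).
      exact: compact_closedI Ec (closed_le_fun (cc R 0) cpsi).
    have [[e' [q' a']] [Ez psiz] zmin] := compact_argmin F0 Fc ce.
    have e'0 : 0 < e'.
      have [[/=]] := Ez; rewrite in_itv /= le_eqVlt => /andP[/orP[|//]].
      by move=> /eqP/esym e'0 _ _ _; have := psi_lt0 _ Ez e'0; rewrite ltNge psiz.
    exists (Num.min 2^-1 (e' / 2)); split=> [||q a Eqa].
    - by rewrite lt_min invr_gt0 ltr0n divr_gt0.
    - by rewrite ge_min lexx.
    have: 0 < Num.min 2^-1 (e' / 2) by rewrite lt_min invr_gt0 ltr0n divr_gt0.
    move=> /(psi_ge0 _ Eqa) psi0; have := zmin _ (conj Eqa psi0) => /=.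
    by apply/negP; rewrite -ltNge gt_min; apply/orP; right; lra.
  exists 2^-1; split=> // q a Eqa.
  apply: F0; exists (2^-1, (q, a)); split=> //; apply: (psi_ge0 _ Eqa).
  by rewrite /= invr_gt0 ltr0n.
pose l := 1 - e ^+ 2.
have l0 : 0 < l by rewrite /l; nra.
(* This translation makes t + q = l y equivalent to q + e v = x0 + l (y - x0). *)
exists l, (e *: v - (1 - l) *: x0); split=> [|q Mq].
  by rewrite ltW //= /l; nra.
pose y := x0 + l^-1 *: (q + e *: v - x0).
have yE : q + e *: v = x0 + l *: (y - x0).
  rewrite /y [x0 + l^-1 *: _]addrC addrK scalerA mulfV ?gt_eqF // scale1r.
  by rewrite [RHS]addrC subrK.
exists y; last first.
  by rewrite /y; apply/rowP => i; rewrite !mxE; field; rewrite gt_eqF.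
(* If y were outside D, the normalised y - d would separate q + e v from the shrunken copy and give
   a triple in E, which e excludes. *)
have [d Dd dsep] := separating_projection y (ex_intro _ x0 Dx0) Dc Dconv.
have [->//|yd] := eqVneq y d.
have a0 : 0 < `|y - d| by rewrite normr_gt0 subr_eq0.
exfalso; apply: (eE q (`|y - d|^-1 *: (y - d))); split=> /=.
  split; first by rewrite /= in_itv /= ltW //=; lra.
  split=> //; split.
    apply: direction_spaceZ.
    have -> : y - d = (x0 - d) + l^-1 *: ((q - x0) + e *: v).
      by rewrite /y; apply/rowP => i; rewrite !mxE; ring.
    apply: direction_spaceD; first exact: direction_spaceB.
    apply: direction_spaceZ; apply: direction_spaceD; last exact: direction_spaceZ.
    by apply: direction_spaceB => //; exact: MD.
  by rewrite normrZ normrV ?unitfE ?gt_eqF // normr_id mulVf // gt_eqF.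
move=> x Dx; rewrite -/l yE !dotZl ler_pM2l ?invr_gt0 //.
rewrite !dotDr lerD2l !dotZr ler_pM2l // !dotBr lerD2r.
apply: le_trans (dsep x Dx) _; rewrite -subr_ge0 -dotBr; exact: dot_ge0.
Qed.

(** By [shrink], 0 is a convex combination of touching normals. Weighting the inequalities of the
    halfspaces by its coefficients cancels every translation, so the factor l alone must
    compensate. *)
Lemma optimal_containment M D : compact M -> compact D ->
  convex_set D -> D !=set0 -> M `<=` D ->
  (forall l t, 0 <= l < 1 ->
    ~ forall q, M q -> exists2 d, D d & t + q = l *: d) ->
  exists k (a : 'I_k -> V) (b : 'I_k -> R),
    [/\ forall i, a i != 0,
        forall i x, D x -> dot (a i) x <= b i,
        forall i, exists2 q, M q & dot (a i) q = b i &
        forall l t, 0 <= l ->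
          (forall q, M q ->
            exists2 y, (forall i, dot (a i) y <= b i) & t + q = l *: y) ->
          1 <= l].
Proof.
move=> Mc Dc Dconv [x0 Dx0] MD optimal.
have noshrink v : direction_space D v ->
    ~ forall a, touching_normals M D a -> dot a v < 0.
  move=> Dv /(shrink Mc Dc Dconv Dx0 MD Dv)[l [t [l01]]]; exact: optimal.
have N0 : touching_normals M D !=set0.
  (* Without touching normals the condition on v is vacuous, so v = 0 would do. *)
  apply: contrapT => N0; apply: (@noshrink 0) => [w _|a Na]; first exact: dot0r.
  by case: N0; exists a.
have [w [a [c [Na c0 c1 wE]]] wmin] :=
  min_norm_convex_comb N0 (compact_touching_normals (D := D) Mc).
have Da i : direction_space D (a i) by case: (Na i) => [[]].
have w_eq0 : w = 0.
  apply: contrapT => /eqP /dot_gt0 w_gt0; apply: (@noshrink (- w)) => [u Du|u Nu].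
    rewrite wE dotNr dot_sumr big1 ?oppr0 // => i _.
    by rewrite dotZr (Da i) // mulr0.
  by rewrite dotNr oppr_lt0 dotC (lt_le_trans w_gt0) ?wmin.
have aN0 i : a i != 0.
  by rewrite -normr_gt0; case: (Na i) => [[_ ->]].
have /choice[q qP] i :
    exists q, M q /\ forall x, D x -> dot (a i) x <= dot (a i) q.
  by case: (Na i) => _ [q Mq qmax]; exists q.
pose b i := dot (a i) (q i).
exists n.+1, a, b; split=> // [i x /(qP i).2//|i|l t l0 tl].
  by exists (q i); first exact: (qP i).1.
have ca0 x : \sum_i c i * dot (a i) x = 0.
  transitivity (dot w x); last by rewrite w_eq0 dot0l.
  by rewrite wE dot_suml; apply: eq_bigr => i _; rewrite dotZl.
pose S := \sum_i c i * b i.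
have SE x : S = \sum_i c i * (b i + dot (a i) x).
  by under eq_bigr do rewrite mulrDr; rewrite big_split /= ca0 addr0.
(* The i-th term b i + dot (a i) t is dot (a i) (t + q i), which is at most l * b i. *)
have S_le : S <= l * S.
  rewrite {1}(SE t) mulr_sumr; apply: ler_sum => i _.
  rewrite mulrCA ler_wpM2l //; have [y yP tq] := tl _ (qP i).1.
  by rewrite addrC -dotDr tq dotZr ler_wpM2l.
(* Translating by a point -x with x in D makes all terms nonnegative. For an i of positive weight, x
   can be chosen where a i is not maximal on D. *)
have S_gt0 : 0 < S.
  have /existsP[i ci] : [exists i, 0 < c i].
    apply/contraT => /existsPn cle0; suff : \sum_i c i <= 0 by rewrite c1 ler10.
    by apply: sumr_le0 => i _; rewrite leNgt.
  have [x [y [Dx Dy lt_xy]]] := direction_space_nonconst (Da i) (aN0 i).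
  rewrite (SE (- x)) (bigD1 i) //= ltr_pwDl //.
    by rewrite dotNr mulr_gt0 // subr_gt0 (lt_le_trans lt_xy) // (qP i).2.
  apply: sumr_ge0 => m _; rewrite dotNr mulr_ge0 // subr_ge0.
  exact: (qP m).2.
by rewrite -(ler_pM2r S_gt0) mul1r.
Qed.

End Touching.

(** * Minkowski sums, circumradii and cylinders *)

Section Minkowski.
Context {R : realType} {n : nat}.
Implicit Types (A B C : set 'rV[R]_n).

Lemma minkowskiA : associative (@minkowski R n).
Proof.
move=> A B C; apply/seteqP; split=> [_ [x Ax [_ [y By [z Cz <-]] <-]]|].
  by rewrite addrA; exists (x + y); [exists x => //; exists y|exists z].
move=> _ [_ [x Ax [y By <-]] [z Cz <-]]; rewrite -addrA; exists x => //.
by exists (y + z) => //; exists y => //; exists z.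
Qed.

Lemma minkowskiC : commutative (@minkowski R n).
Proof.
by move=> A B; apply/seteqP; split=> _ [x Ax [y By <-]];
  rewrite addrC; exists y => //; exists x.
Qed.

Lemma mink0set : left_id [set 0] (@minkowski R n).
Proof.
move=> A; apply/seteqP; split=> [_ [_ -> [y Ay <-]]|x Ax]; first by rewrite add0r.
by exists 0 => //; exists x => //; rewrite add0r.
Qed.

HB.instance Definition _ := Monoid.isComLaw.Build (set 'rV[R]_n) [set 0]
  (@minkowski R n) minkowskiA minkowskiC mink0set.

Lemma minkowski_convex A B : convex_set A -> convex_set B ->
  convex_set (minkowski A B).
Proof.
move=> /convex_setP cA /convex_setP cB; apply/convex_setP.
move=> _ _ s [x Ax [y By <-]] [x' Ax' [y' By' <-]] s01.
exists (s *: x + (1 - s) *: x'); first exact: cA.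
exists (s *: y + (1 - s) *: y'); first exact: cB.
by rewrite !scalerDr addrACA.
Qed.

Lemma minkowski_sum_convex j (D : pred 'I_j) (K : 'I_j -> set 'rV[R]_n) :
  (forall i, D i -> convex_set (K i)) -> convex_set (minkowski_sum D K).
Proof.
move=> cK; apply: (big_ind (fun A : set 'rV[R]_n => convex_set A)) => //;
  last exact: minkowski_convex.
apply/convex_setP => x y s -> -> _ /=.
by rewrite !scaler0 addr0.
Qed.

Lemma minkowski_sum_nonempty j (D : pred 'I_j) (K : 'I_j -> set 'rV[R]_n) :
  (forall i, D i -> K i !=set0) -> minkowski_sum D K !=set0.
Proof.
move=> K0; apply: (big_ind (fun A => A !=set0)) => //; first by exists 0.
by move=> A B [x Ax] [y By]; exists (x + y), x => //; exists y.
Qed.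

Lemma minkowski_sumD1 j (K : 'I_j -> set 'rV[R]_n) i :
  minkowski_sum predT K = minkowski (K i) (minkowski_sum (predC1 i) K).
Proof. by rewrite /minkowski_sum (bigD1 i). Qed.

End Minkowski.

(** * Bounds on the circumradius and its attainment *)

Section Circumradius.
Context {R : realType} {n : nat}.
Notation V := 'rV[R]_n.
Implicit Types (A C K L P D : set V) (l r : R) (p t x : V).

Definition fits l K C :=
  exists t, forall x, K x -> exists2 c, C c & t + x = l *: c.

Lemma homothet_fits l K C :
  (exists t, homothet t 1 K `<=` homothet 0 l C) <-> fits l K C.
Proof.
split=> [[t tKC]|[t tKC]]; exists t.
  move=> x Kx; have [|c Cc cE] := tKC (t + x); first by exists x; rewrite ?scale1r.
  by exists c; rewrite // -cE add0r.
move=> _ [x Kx <-]; have [c Cc cE] := tKC x Kx.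
by exists c; rewrite // scale1r add0r.
Qed.

Lemma circumradius_le l K C : 0 <= l -> fits l K C ->
  (circumradius K C <= l%:E)%E.
Proof.
by move=> l0 /homothet_fits lKC; apply: ereal_inf_lbound; exists l.
Qed.

Lemma le_circumradius (m : \bar R) K C :
  (forall l, 0 <= l -> fits l K C -> (m <= l%:E)%E) -> (m <= circumradius K C)%E.
Proof.
by move=> mP; apply: le_ereal_inf_tmp => _ [l [l0 /homothet_fits lKC] <-]; exact: mP.
Qed.

Lemma circumradius_ltP (m : \bar R) K C : (circumradius K C < m)%E ->
  exists l, [/\ 0 <= l, fits l K C & (l%:E < m)%E].
Proof.
by move=> /ereal_inf_lt[_ [l [l0 /homothet_fits lKC] <-] lm]; exists l.
Qed.

Lemma circumradius_ge0 K C : (0 <= circumradius K C)%E.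
Proof. by apply: le_circumradius => l l0 _; rewrite lee_fin. Qed.

Lemma circumradius_mono p K L C : (forall x, K x -> L (p + x)) ->
  (circumradius K C <= circumradius L C)%E.
Proof.
move=> KL; apply: le_circumradius => l l0 [t tLC]; apply: circumradius_le => //.
by exists (t + p) => x /KL /tLC[c Cc tE]; exists c; rewrite // -addrA.
Qed.

(** If C lies in a ball of radius B', then l C has diameter at most 2 l B', which must be at least
    the distance from x to y. *)
Lemma circumradius_gt0 K C x y : compact C -> K x -> K y -> x != y ->
  (0 < circumradius K C)%E.
Proof.
move=> /compact_bounded[B [_ CB]] Kx Ky xy.
pose B' := Num.max 1 (B + 1).
have B'0 : 0 < B' by rewrite lt_max ltr01.
have {}CB c : C c -> `|c| <= B'.
  by move=> /(CB B'); apply; rewrite lt_max ltrDl ltr01 orbT.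
have xy0 : 0 < `|x - y| by rewrite normr_gt0 subr_eq0.
apply: (@lt_le_trans _ _ (`|x - y| / (B' + B'))%:E).
  by rewrite lte_fin divr_gt0 // addr_gt0.
apply: le_circumradius => l l0 [t tKC]; rewrite lee_fin.
have [c Cc cE] := tKC x Kx; have [d Cd dE] := tKC y Ky.
rewrite ler_pdivrMr ?addr_gt0 //.
have -> : x - y = l *: (c - d).
  by rewrite scalerBr -cE -dE opprD addrACA subrr add0r.
rewrite normrZ ger0_norm // ler_wpM2l // (le_trans (ler_normB _ _)) //.
by rewrite lerD // CB.
Qed.

Lemma circumradius_attained r K C : K !=set0 -> compact C ->
  circumradius K C = r%:E -> 0 < r -> fits r K C.
Proof.
move=> [x0 Kx0] Cc rE r0.
(* The factor l is replaced by its inverse to make the containment a closed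
   condition. *)
pose S : set (R * V) := (`[(r + 1)^-1, r^-1]%classic `*` C) `&`
  [set z | forall x, K x -> C (z.1 *: (x - x0) + z.2)].
have fits_ge l : 0 <= l -> fits l K C -> r <= l.
  by move=> l0 lKC; rewrite -lee_fin -rE circumradius_le.
have S_fits m c : 0 < m -> S (m, c) -> fits m^-1 K C.
  move=> m0 [_ /= cP]; exists (m^-1 *: c - x0) => x /cP Cx.
  eexists; first exact: Cx.
  by rewrite scalerDr scalerA mulVf ?gt_eqF // scale1r
    -[LHS]addrA addrC [- x0 + x]addrC.
(* A placement is recorded by the point c of C that x0 is sent to, so it ranges over a compact set,
   unlike the translation t. *)
have fits_S l : l <= r + 1 -> 0 <= l -> fits l K C -> exists c, S (l^-1, c).
  move=> lr l0 lKC; have rl := fits_ge l l0 lKC.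
  have {}l0 : 0 < l by exact: lt_le_trans rl.
  have [t tKC] := lKC; have [c Cc' cE] := tKC x0 Kx0; exists c; split=> /=.
    by split=> //=; rewrite in_itv /= !lef_pV2 ?posrE ?addr_gt0 // lr.
  move=> x Kx; have [d Cd dE] := tKC x Kx.
  suff -> : l^-1 *: (x - x0) + c = d by [].
  apply: (scalerI (lt0r_neq0 l0)); rewrite scalerDr scalerA mulfV ?gt_eqF //.
  by rewrite scale1r -cE -dE addrCA subrK.
have S0 : S !=set0.
  have : (circumradius K C < (r + 1)%:E)%E by rewrite rE lte_fin ltrDl.
  move=> /circumradius_ltP[l [l0 lKC lr]].
  by have [|c Sc] := fits_S l _ l0 lKC; [exact: ltW|exists (l^-1, c)].
have Sc : compact S.
  apply: compact_closedI.
    by apply: compact_setX => //; exact: segment_compact.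
  apply: closed_forall => x _.
  apply: (@preimage_closed _ _ (fun z : R * V => z.1 *: (x - x0) + z.2) C).
    move=> z _; apply: (continuous_add (continuous_scale (@continuous_fst _ _)
      (@cst_continuous _ _ _)) (@continuous_snd _ _)).
  exact: compact_closed (@norm_hausdorff _ _) Cc.
have cf : continuous (fun z : R * V => - z.1).
  by move=> z; apply: cvgN; exact: cvg_fst.
have [[m c] Smc mmax] := compact_argmin S0 Sc cf.
have m0 : 0 < m.
  have [[/= + _] _] := Smc; rewrite in_itv /= => /andP[+ _].
  by apply: lt_le_trans; rewrite invr_gt0 addr_gt0.
have mKC := S_fits _ _ m0 Smc.
have rm : r <= m^-1 by apply: fits_ge => //; rewrite invr_ge0 ltW.
suff -> : r = m^-1 by [].
apply/eqP; rewrite eq_le rm /= leNgt; apply/negP => mr.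
have : (circumradius K C < (m^-1)%:E)%E by rewrite rE lte_fin.
move=> /circumradius_ltP[l [l0 lKC]]; rewrite lte_fin => lm.
have [|d /mmax /=] := fits_S l _ l0 lKC.
  have [[/= + _] _] := Smc; rewrite in_itv /= => /andP[rm1 _].
  by rewrite (le_trans (ltW lm)) // -[leRHS]invrK lef_pV2 ?posrE ?invr_gt0 ?addr_gt0.
have {}l0 : 0 < l by exact: lt_le_trans (fits_ge l l0 lKC).
by rewrite lerN2 leNgt -[X in X < _]invrK ltf_pV2 ?posrE ?invr_gt0 // lm.
Qed.

End Circumradius.

(** * Construction of the cylinders *)

Section Cylinders.
Context {R : realType} {n : nat}.
Notation V := 'rV[R]_n.
Implicit Types (A C K L P D : set V).

(** All a i vanish on a direction w of aff L, so the cylinder is invariant under translation by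
    multiples of w. A functional u bounding it must then vanish on w as well, and the facet F
    contains f + w along with f. *)
Lemma cylinder_facets k (a : 'I_k -> V) (b : 'I_k -> R) L :
  (forall i x y, L x -> L y -> dot (a i) x = dot (a i) y) ->
  facets_parallel_to (\bigcap_i halfspace (a i) (b i)) (affine_hull L).
Proof.
move=> aL F [u [c [Pu FE [d [_ [p [M [_ affF]]]]]]]] w wA.
have aw i : dot (a i) w = 0.
  case: wA => x [k1 [x' [s [Lx s1 xE]]]] [y [k2 [y' [t [Ly t1 yE]]]] <-].
  have [k1_0|[i1]] : k1 = 0%N \/ inhabited 'I_k1.
  - by case: k1 {x' s Lx s1 xE} => [|m]; [left|right; exists; exact: ord0].
  - subst k1; move/eqP: s1; rewrite big_ord0 eq_sym oner_eq0 //.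
  have hull m (f : 'I_m -> V) (e : 'I_m -> R) : (forall i, L (f i)) ->
      \sum_i e i = 1 -> dot (a i) (\sum_i e i *: f i) = dot (a i) (x' i1).
    move=> Lf e1; rewrite dot_sumr; under eq_bigr => m' _.
      rewrite dotZr (aL i _ _ (Lf m') (Lx i1)); over.
    by rewrite -mulr_suml e1 mul1r.
  by rewrite dotBr xE yE !hull // subrr.
have PD x s : (\bigcap_i halfspace (a i) (b i)) x ->
    (\bigcap_i halfspace (a i) (b i)) (x + s *: w).
  by move=> Px i _; rewrite /halfspace /= dotDr dotZr aw mulr0 addr0; exact: Px.
have [f Ff] : F !=set0.
  have : affine_hull F p by rewrite affF /= subrr sub0mx.
  move=> [[|m] [x [e [Fx e1 _]]]]; last by exists (x ord0); exact: Fx.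
  by move/eqP: e1; rewrite big_ord0 eq_sym oner_eq0.
have [Pf uf] : (\bigcap_i halfspace (a i) (b i) `&` hyperplane u c) f.
  by rewrite -FE.
have uw : dot u w = 0.
  have := Pu _ (PD f 1 Pf); have := Pu _ (PD f (-1) Pf).
  rewrite /halfspace /= !dotDr !dotZr; rewrite /hyperplane /= in uf.
  by rewrite uf => h1 h2; apply/eqP; rewrite eq_le; apply/andP; split; lra.
have Ffw : F (f + w).
  rewrite FE; split; first by rewrite -[w]scale1r; exact: PD.
  by rewrite /hyperplane /= dotDr uw addr0.
have hullF x : F x -> affine_hull F x.
  move=> Fx; exists 1%N, (fun=> x), (fun=> 1); split=> //.
    by rewrite big_ord1.
  by rewrite big_ord1 scale1r.
exists (f + w); first exact: (hullF _ Ffw).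
by exists f; [exact: (hullF _ Ff)|rewrite addrC addKr].
Qed.

Lemma touching_cylinder K L D : K !=set0 -> compact K ->
  L !=set0 -> convex_set L -> compact D -> convex_set D ->
  minkowski K L `<=` D ->
  (forall l t, 0 <= l < 1 ->
    ~ forall x, K x -> exists2 d, D d & t + x = l *: d) ->
  exists P, [/\ polyhedral_cylinder P, facets_parallel_to P (affine_hull L),
    D `<=` P & circumradius K P = 1%:E].
Proof.
move=> [x0 Kx0] Kc L0 Lconv Dc Dconv KLD optimal.
have [p Lp pmax] := relint_point L0 Lconv.
pose M := (fun x => x + p) @` K.
have Mc : compact M.
  apply: continuous_compact => //; apply: continuous_subspaceT.
  exact: (continuous_add (@continuous_idfun V) (@cst_continuous _ _ _)).
have MD : M `<=` D by move=> _ [x Kx <-]; apply: KLD; exists x => //; exists p.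
have D0 : D !=set0 by exists (x0 + p); apply: MD; exists x0.
have [|k [a [b [a0 Db Mb Popt]]]] := optimal_containment Mc Dc Dconv D0 MD.
  move=> l t l01 tMD; apply: (optimal l (t + p) l01) => x Kx.
  have [|d Dd tE] := tMD (x + p); first by exists x.
  by exists d; rewrite // -tE [x + p]addrC addrA.
exists (\bigcap_i halfspace (a i) (b i)); split.
- by exists k, a, b.
- have ap i x : L x -> dot (a i) x = dot (a i) p.
    apply: pmax => {}x Lx; have [_ [q Kq <-] qb] := Mb i.
    rewrite -(lerD2l (dot (a i) q)) -!dotDr qb; apply: Db.
    by apply: KLD; exists q => //; exists x.
  by apply: cylinder_facets => i x y Lx Ly; rewrite !ap.
- by move=> x Dx i _; exact: Db.
apply/eqP; rewrite eq_le; apply/andP; split.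
  apply: circumradius_le => //; exists p => x Kx; exists (x + p).
    by move=> i _; apply: Db; apply: MD; exists x.
  by rewrite scale1r addrC.
apply: le_circumradius => l l0 [t tKP]; rewrite lee_fin.
apply: (Popt l (t - p)) => // _ [x Kx <-]; have [y Py tE] := tKP x Kx.
by exists y => [i|]; [exact: Py|rewrite -tE addrACA addNr addr0].
Qed.

End Cylinders.

(** * Homothets *)

Section Homothet.
Context {R : realType} {n : nat}.
Implicit Types (C K P : set 'rV[R]_n).

Lemma homothet_compact z (l : R) C : compact C -> compact (homothet z l C).
Proof.
move=> Cc; apply: continuous_compact => //; apply: continuous_subspaceT.
exact: (continuous_add (@cst_continuous _ _ _)
  (continuous_scale (@cst_continuous _ _ _) (@continuous_idfun _))).
Qed.

Lemma homothet_convex z (l : R) C : convex_set C -> convex_set (homothet z l C).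
Proof.
move=> /convex_setP cC; apply/convex_setP => _ _ s [x Cx <-] [y Cy <-] s01.
exists (s *: x + (1 - s) *: y); first exact: cC.
by apply/rowP => i; rewrite !mxE; ring.
Qed.

(** A translate of K inside m C lies, up to translation, in m / l times z + l C, hence in m / l
    times P; so m / l >= 1. *)
Lemma le_circumradius_homothet z (l : R) K C P : 0 < l ->
  homothet z l C `<=` P -> circumradius K P = 1%:E ->
  (l%:E <= circumradius K C)%E.
Proof.
move=> l0 CP KP; apply: le_circumradius => m m0 [t tKC]; rewrite lee_fin.
suff: (1%:E <= (m / l)%:E :> \bar R)%E by rewrite lee_fin ler_pdivlMr // mul1r.
rewrite -KP; apply: circumradius_le; first by rewrite divr_ge0 // ltW.
exists (t + (m / l) *: z) => x /tKC[c Cc cE].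
exists (z + l *: c); first by apply: CP; exists c.
by rewrite addrAC cE scalerDr scalerA divfK ?gt_eqF // addrC.
Qed.

End Homothet.

(** * The inequality and its equality case *)

Theorem theorem1p4 (R : realType) (n j : nat)
    (K : 'I_j -> set 'rV[R]_n) (C : set 'rV[R]_n)
    (hK : forall i, convex_body (K i)) (hC : convex_body C) :
  (\sum_(i < j) circumradius (K i) C
     <= j%:R%:E * circumradius (minkowski_sum predT K) C)%E
  /\
  ((* the K i are not all singletons, and the circumradius of the sum exists *)
   (exists i, forall x, K i <> [set x]) ->
   (circumradius (minkowski_sum predT K) C < +oo)%E ->
   ((\sum_(i < j) circumradius (K i) C
       = j%:R%:E * circumradius (minkowski_sum predT K) C)%E
    <->
    exists (Cyl : 'I_j -> set 'rV[R]_n) (lambda : R) (z : 'rV[R]_n),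
      [/\ forall i, polyhedral_cylinder (Cyl i) /\
            facets_parallel_to (Cyl i)
              (affine_hull (minkowski_sum (predC1 i) K)),
          0 < lambda,
          minkowski_sum predT K `<=` homothet z lambda C,
          homothet z lambda C `<=` \bigcap_i Cyl i
        & forall i, circumradius (K i) (Cyl i) = 1%:E])).
Proof.
have [C0 Cconv Cc] := hC.
have L0 (D : pred 'I_j) : minkowski_sum D K !=set0.
  by apply: minkowski_sum_nonempty => i _; case: (hK i).
have KS i : (circumradius (K i) C <= circumradius (minkowski_sum predT K) C)%E.
  have [p Lp] := L0 (predC1 i); apply: (@circumradius_mono _ _ p) => x Kx.
  by rewrite (minkowski_sumD1 K i) addrC; exists x => //; exists p.
have sum_const (m : \bar R) : (\sum_(i < j) m = j%:R%:E * m)%E.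
  by rewrite sumr_const card_ord mule_natl.
have ineq : (\sum_(i < j) circumradius (K i) C
     <= j%:R%:E * circumradius (minkowski_sum predT K) C)%E.
  by rewrite -sum_const; apply: lee_sum => i _.
split=> // -[i0 Ki0] Sfin; split=> [sumE|[Cyl [l [z [_ l0 SC CCyl CylE]]]]]; last first.
  (* Sufficiency: l lies between the circumradius of the sum and that of each K i. *)
  apply/eqP; rewrite eq_le ineq /= -sum_const.
  apply: lee_sum => i _; apply: (@le_trans _ _ l%:E).
    apply: circumradius_le; first exact: ltW.
    exists (- z) => x /SC[c Cc' <-]; exists c => //; exact: addKr.
  apply: (@le_circumradius_homothet _ _ z l _ _ (Cyl i)) => //.
  by move=> x /CCyl; exact.
pose r := fine (circumradius (minkowski_sum predT K) C).
have rE : circumradius (minkowski_sum predT K) C = r%:E.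
  by rewrite fineK // ge0_fin_numE ?circumradius_ge0.
have KrE i : circumradius (K i) C = r%:E.
  have Kfin m : circumradius (K m) C \is a fin_num.
    by rewrite ge0_fin_numE ?circumradius_ge0 // (le_lt_trans (KS m)).
  have Kle m : fine (circumradius (K m) C) <= r.
    by rewrite -lee_fin fineK // -rE.
  (* The gaps are nonnegative and sum to 0, so each is 0. *)
  have : \sum_(m < j) (r - fine (circumradius (K m) C)) == 0.
    rewrite sumrB subr_eq0 sumr_const card_ord -mulr_natl -eqe EFinM -rE -sumE.
    by rewrite -sumEFin; apply/eqP; apply: eq_bigr => m _; rewrite fineK.
  rewrite psumr_eq0 => [/allP/(_ i (mem_index_enum _))|m _]; last first.
    by rewrite subr_ge0.
  by rewrite subr_eq0 => /eqP ->; rewrite fineK.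
have r0 : 0 < r.
  have [[x Kx] _ _] := hK i0.
  have [y Ky xy] : exists2 y, K i0 y & x != y.
    apply: contrapT => Kxy; apply: (Ki0 x); apply/seteqP; split=> [y Ky|_ ->//].
    by apply/esym/eqP/negPn/negP => xy; apply: Kxy; exists y.
  by rewrite -lte_fin -(KrE i0); exact: circumradius_gt0 Kx Ky xy.
have [t tSC] := circumradius_attained (L0 predT) Cc rE r0.
have SD : minkowski_sum predT K `<=` homothet (- t) r C.
  by move=> x /tSC[c Cc' cE]; exists c; rewrite // -cE addKr.
have /choice[Cyl CylP] i : exists P, [/\ polyhedral_cylinder P,
    facets_parallel_to P (affine_hull (minkowski_sum (predC1 i) K)),
    homothet (- t) r C `<=` P & circumradius (K i) P = 1%:E].
  have [K0 Kconv Kc] := hK i.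
  apply: touching_cylinder => //.
  - by apply: minkowski_sum_convex => m _; case: (hK m).
  - exact: homothet_compact.
  - exact: homothet_convex.
  - by rewrite -minkowski_sumD1.
  (* A copy of D scaled by l < 1 that contains a translate of K i would give R(K i, C) <= l r <
     r. *)
  move=> l s /andP[l0 l1] sKD.
  have : (r%:E <= (l * r)%:E)%E.
    rewrite -(KrE i); apply: circumradius_le; first by rewrite mulr_ge0 // ltW.
    exists (s + l *: t) => x /sKD[_ [c Cc' <-] sE]; exists c => //.
    by rewrite addrAC sE scalerDr scalerN scalerA addrAC addNr add0r.
  by rewrite lee_fin leNgt gtr_pMl // l1.
exists Cyl, r, (- t); split=> // [i|x Dx i _|i].
- by have [] := CylP i.
- by have [_ _ DP _] := CylP i; exact: DP.
- by have [] := CylP i.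
Qed.
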